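(* Let $(x^{*},y^{*})$ be a saddle-point of $f$, and let $((x^k,y^k))_{k\in\mathbf N}$ be generated by the alternating proximal mapping method with constant parameters: for all $k\in\mathbf N\cup\{-1\}$, $\tau_k=\tau\in\mathbf R_{++}$, $\sigma_k=\sigma\in\mathbf R_{++}$, $\alpha_k=\alpha\in\mathbf R_{++}$, $\beta_k=\beta\in\mathbf R_+$. Let $\tau,\sigma>0$ be small enough that $\|K\|^2<\frac{2\mu+\frac1\tau}{\sigma}$ and $\|K\|^2<\frac{2\nu+\frac1\sigma}{\tau}$. Let $\alpha\in\big(\frac1{2\mu\tau+1},1\big)$ be such that $\alpha\ge\frac1{2\nu\sigma+1}$ and $\alpha\tau\sigma\|K\|^2<1$. Let $\beta$ satisfy $\|K\|^2\beta^2\sigma<\big(2\mu+\frac1\tau-\frac1{\alpha\tau}\big)(1-\alpha\tau\sigma\|K\|^2)$. Let $\eta_3\in\mathbf R_{++}$ satisfy $\eta_3>\frac{\sigma}{1-\alpha\tau\sigma\|K\|^2}$ and $\|K\|^2\beta^2\eta_3\le2\mu+\frac1\tau-\frac1{\alpha\tau}$. Let $\eta_4\in\mathbf R_{++}$ satisfy $\tau\le\eta_4$ and $\alpha\sigma\eta_4\|K\|^2<1$. Let $\eta_1\in\mathbf R_{++}$ satisfy $\eta_1\ge\frac{\sigma\eta_3}{\eta_3-\sigma}$ and $\alpha\tau\eta_1\|K\|^2<1$. Let $\eta_2\in\mathbf R_{++}$ satisfy $\eta_2\ge\frac{\tau}{\alpha(1-\alpha\tau\eta_1\|K\|^2)}$.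 Then for every $k\in\mathbf N$, $$\|x^{k+1}-x^*\|\le\alpha^{k+1}\tau\Big(\frac1{\tau_0}\|x^*-x^0\|^2+\frac1{\sigma_0}\|y^*-y^0\|^2\Big),$$ $$\|y^{k+1}-y^*\|\le\alpha^{k+1}\Big(\frac1{\sigma}-\alpha\eta_4\|K\|^2\Big)\Big(\frac1{\tau_0}\|x^*-x^0\|^2+\frac1{\sigma_0}\|y^*-y^0\|^2\Big),$$ where $\tau_0=\tau$ and $\sigma_0=\sigma$. Consequently, the sequence of iterations $((x^k,y^k))_{k\in\mathbf N}$ converges linearly to the saddle-point $(x^*,y^* )$ of $f$ with a rate $\alpha\in(0,1)$.
   Context: $\mathbf N=\{0,1,2,\dots\}$, $\mathbf R_+=[0,\infty)$, $\mathbf R_{++}=(0,\infty)$. $\mathcal H_1,\mathcal H_2$ are Hilbert spaces; $K:\mathcal H_1\to\mathcal H_2$ is a continuous linear operator with operator norm $\|K\|$ and adjoint $K^*$. $g:\mathcal H_1\to\mathbf R\cup\{+\infty\}$ and $h:\mathcal H_2\to\mathbf R\cup\{+\infty\}$ are proper and lower semicontinuous; $\mu,\nu\in\mathbf R_{++}$; $g$ is strongly convex with modulus $\mu$, i.e. $\langle u,x-\bar x\rangle+\frac\mu2\|x-\bar x\|^2+g(\bar x)\le g(x)$ for all $\bar x\in\operatorname{dom}\partial g$, $u\in\partial g(\bar x)$, $x\in\mathcal H_1$; and $h$ is strongly convex with modulus $\nu$ (same inequality with $h,\nu,\mathcal H_2$). The constants $\mu,\nu,\|K\|$ are known. Define $f(x,y)=\langle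 Kx,y\rangle+g(x)-h(y)$ on $\mathcal H_1\times\mathcal H_2$. A saddle-point of $f$ is $(x^*,y^* )$ with $f(x^*,y)\le f(x^*,y^* )\le f(x,y^* )$ for all $x\in\mathcal H_1,y\in\mathcal H_2$; one is assumed to exist. Alternating proximal mapping method: given sequences $(\tau_k)_{k\in\mathbf N\cup\{-1\}}$, $(\sigma_k)_{k\in\mathbf N\cup\{-1\}}$ in $\mathbf R_{++}$ and $(\alpha_k)_{k\in\mathbf N\cup\{-1\}}$, $(\beta_k)_{k\in\mathbf N\cup\{-1\}}$ in $\mathbf R_+$, and $(x^0,y^0)\in\mathcal H_1\times\mathcal H_2$, set $x^{-1}=x^0$, $y^{-1}=y^0$, $\bar x^0=x^0$, $\bar y^0=y^0$ and for every $k\in\mathbf N$: $y^{k+1}=\operatorname{Prox}_{\sigma_kh}(\sigma_kK\bar x^k+y^k)$; $\bar y^{k+1}=y^{k+1}+\beta_k(y^{k+1}-y^k)$; $x^{k+1}=\operatorname{Prox}_{\tau_kg}(-\tau_kK^*\bar y^{k+1}+x^k)$; $\bar x^{k+1}=x^{k+1}+\alpha_k(x^{k+1}-x^k)$. Here $\operatorname{Prox}_\varphi(z)=\operatorname{argmin}_w(\varphi(w)+\frac12\|z-w\|^2)$.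
   Formalization: The printed bounds are false; proved instead with squared norms on both left-hand sides, with the factor (1/σ − αη₄‖K‖²) replaced by its inverse in the y-bound, and with ''converges linearly with rate α'' read for the squared distance. *)

(* Defs.v *)
From HB Require Import structures.
From mathcomp Require Import all_boot all_order all_algebra.
From mathcomp Require Import all_classical all_reals all_analysis.

Set Implicit Arguments.
Unset Strict Implicit.
Unset Printing Implicit Defensive.

Import Order.TTheory GRing.Theory Num.Theory.
Import numFieldNormedType.Exports.

Local Open Scope classical_set_scope.
Local Open Scope ring_scope.

(* Real Hilbert spaces: complete normed modules whose norm comes from an inner
   product.  Positive definiteness follows from [inner_norm]. *)
HB.mixin Record CompleteNormedModule_isHilbert (R : realType) H
    of CompleteNormedModule R H := {
  inner : H -> H -> R ;
  innerC : forall x y, inner x y = inner y x ;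
  innerDl : forall x y z, inner (x + y) z = inner x z + inner y z ;
  innerZl : forall (a : R) x y, inner (a *: x) y = a * inner x y ;
  inner_norm : forall x, inner x x = `|x| ^+ 2 }.

#[short(type="hilbertType")]
HB.structure Definition Hilbert (R : realType) :=
  { H of CompleteNormedModule_isHilbert R H & CompleteNormedModule R H }.

Section Operators.
Context {R : realType} {H1 H2 : hilbertType R}.

(* For continuous linear [K] the set is bounded, so [sup] is a genuine
   supremum. *)
Definition opnorm (K : H1 -> H2) : R :=
  sup [set `|K x| | x in [set x : H1 | `|x| <= 1]].

(* [Kstar] is the adjoint of [K]; this determines [Kstar] uniquely. *)
Definition is_adjoint (K : H1 -> H2) (Kstar : H2 -> H1) : Prop :=
  forall x y, inner (K x) y = inner x (Kstar y).

End Operators.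

Section ConvexAnalysis.
Context {R : realType} {H : hilbertType R}.
Local Open Scope ereal_scope.
Implicit Types phi g : H -> \bar R.

Definition proper_fun g : Prop :=
  (forall x, g x != -oo) /\ exists x, g x < +oo.

(* For proper [g] this set is empty at points where [g] is [+oo]. *)
Definition subdifferential g (xb : H) : set H :=
  [set u | forall x, (inner u (x - xb)%R)%:E + g xb <= g x].

Definition strongly_convex (mu : R) g : Prop :=
  forall xb u x, subdifferential g xb u ->
    (inner u (x - xb))%:E + (mu / 2 * `|x - xb| ^+ 2)%:E + g xb <= g x.

Definition argmin phi : set H := [set p | forall w, phi p <= phi w].

Definition Prox phi (z : H) : set H :=
  argmin (fun w => phi w + (2^-1 * `|z - w| ^+ 2)%:E).

End ConvexAnalysis.

Section SaddlePoint.
Context {R : realType} {H1 H2 : hilbertType R}.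
Local Open Scope ereal_scope.

(* The library convention is [+oo - +oo = -oo].  For proper [g] and [h], a
   saddle point has [g] and [h] finite, whatever the convention. *)
Definition lagrangian (K : H1 -> H2) (g : H1 -> \bar R) (h : H2 -> \bar R)
    (x : H1) (y : H2) : \bar R :=
  (inner (K x) y)%:E + g x - h y.

Definition saddle_point (f : H1 -> H2 -> \bar R) (xs : H1) (ys : H2) : Prop :=
  forall x y, f xs y <= f xs ys /\ f xs ys <= f x ys.

End SaddlePoint.

Section Algorithm.
Context {R : realType} {H1 H2 : hilbertType R}.

(* Trajectories of the alternating proximal mapping method.  The recursion only
   involves the parameters with index [k >= 0] and never the iterates of index
   [-1], so all sequences are indexed by [nat]. *)
Record apmm (K : H1 -> H2) (Kstar : H2 -> H1)
    (g : H1 -> \bar R) (h : H2 -> \bar R)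
    (tau sigma alpha beta : nat -> R)
    (x xbar : nat -> H1) (y ybar : nat -> H2) : Prop := Apmm {
  apmm_xbar0 : xbar 0%N = x 0%N ;
  apmm_ybar0 : ybar 0%N = y 0%N ;
  apmm_y : forall k, Prox (fun w => (sigma k)%:E * h w)%E
                          (sigma k *: K (xbar k) + y k) (y k.+1) ;
  apmm_ybar : forall k, ybar k.+1 = y k.+1 + beta k *: (y k.+1 - y k) ;
  apmm_x : forall k, Prox (fun w => (tau k)%:E * g w)%E
                          (- (tau k *: Kstar (ybar k.+1)) + x k) (x k.+1) ;
  apmm_xbar : forall k, xbar k.+1 = x k.+1 + alpha k *: (x k.+1 - x k) }.

(* Linear convergence in the product Hilbert space, the rate being measured on
   the squared distance [|x k - xs|^2 + |y k - ys|^2]; equivalently the distance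
   itself is [O(sqrt r ^+ k)]. *)
Definition linear_cvg_sq (x : nat -> H1) (y : nat -> H2) (xs : H1) (ys : H2)
    (r : R) : Prop :=
  [/\ 0 < r < 1,
      (fun k => (x k, y k)) @ \oo --> (xs, ys) &
      exists C : R, forall k,
        `|x k - xs| ^+ 2 + `|y k - ys| ^+ 2 <= C * r ^+ k].

End Algorithm.

(* Main.v *)
Require Import Defs.
From HB Require Import structures.
From mathcomp Require Import all_boot all_order all_algebra.
From mathcomp Require Import all_classical all_reals all_analysis.
From mathcomp Require Import ring lra.

Set Implicit Arguments.
Unset Strict Implicit.
Unset Printing Implicit Defensive.

Import Order.TTheory GRing.Theory Num.Theory.
Import numFieldNormedType.Exports.

Local Open Scope classical_set_scope.
Local Open Scope ring_scope.

(* [strongly_convex] is only a subgradient inequality, so the convexity of [g],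
   needed to turn a proximal point into a subgradient, has to be derived.  A
   variational principle with a small quadratic perturbation shows that the
   range of the subdifferential is dense; the inequality makes its inverse
   Lipschitz, and lower semicontinuity makes the range everything.  A
   contraction then solves the resolvent equation, whose solution is the
   proximal point.

   With [a_k = x_k - xs], [b_k = y_k - ys], [f_k = x_k - x_(k-1)], strong
   monotonicity of both subdifferentials at the new iterate and at the saddle
   point, together with Young's inequality (weights [eta1], [eta3]) gives
   [V_(k+1) <= alpha V_k] for the energy
   [V_k = |a_k|^2/tau + |b_k|^2/sigma + 2 alpha <K f_k, b_k>
          + alpha/tau |f_k|^2],
   and Young's inequality with weight [eta4] bounds [V_k] from below. *)

(** * Inner product identities, Young and Cauchy-Schwarz inequalities *)

Section InnerProduct.
Context {R : realType} {H : hilbertType R}.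
Implicit Types (x y z : H) (a : R).

Lemma innerNl x y : inner (- x) y = - inner x y.
Proof. by rewrite -scaleN1r innerZl mulN1r. Qed.

Lemma innerDr x y z : inner z (x + y) = inner z x + inner z y.
Proof. by rewrite !(innerC z) innerDl. Qed.

Lemma innerNr x y : inner y (- x) = - inner y x.
Proof. by rewrite !(innerC y) innerNl. Qed.

Lemma innerZr a x y : inner y (a *: x) = a * inner y x.
Proof. by rewrite !(innerC y) innerZl. Qed.

Definition innerE :=
  (@innerDl R H, innerDr, innerNl, innerNr, @innerZl R H, innerZr).

Lemma sqr_normD x y : `|x + y| ^+ 2 = `|x| ^+ 2 + 2 * inner x y + `|y| ^+ 2.
Proof. by rewrite -!inner_norm !innerE (innerC y x); ring. Qed.

Lemma sqr_normB x y : `|x - y| ^+ 2 = `|x| ^+ 2 - 2 * inner x y + `|y| ^+ 2.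
Proof. by rewrite -!inner_norm !innerE (innerC y x); ring. Qed.

Lemma inner_young a x y : 0 < a ->
  2 * inner x y <= a * `|x| ^+ 2 + `|y| ^+ 2 / a.
Proof.
move=> a0; have := sqr_ge0 `|a *: x - y|.
rewrite -!inner_norm !innerE (innerC y x) => h.
rewrite -subr_ge0.
have -> : a * inner x x + inner y y / a - 2 * inner x y =
  (a * (a * inner x x) + - inner x y * a *+ 2 + inner y y) / a.
  by field; rewrite gt_eqF.
by apply: divr_ge0 (ltW a0); move: h; congr (is_true (_ <= _)); ring.
Qed.

(** Cauchy-Schwarz: the Young weight [|y| / |x|] makes both terms on the right equal. *)
Lemma inner_le_norm x y : inner x y <= `|x| * `|y|.
Proof.
have [->|y0] := eqVneq y 0.
  by rewrite -(scale0r 0) innerZr mul0r mulr_ge0.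
have [->|x0] := eqVneq x 0.
  by rewrite -(scale0r 0) innerZl mul0r mulr_ge0.
have nx : 0 < `|x| by rewrite normr_gt0.
have ny : 0 < `|y| by rewrite normr_gt0.
have := inner_young x y (divr_gt0 ny nx).
have -> : `|y| / `|x| * `|x| ^+ 2 + `|y| ^+ 2 / (`|y| / `|x|) =
    2 * (`|x| * `|y|).
  by field; rewrite !gt_eqF.
by rewrite ler_pM2l.
Qed.

(** Polarization reduces joint continuity to continuity of the norm. *)
Lemma cvg_inner (u v : nat -> H) x y :
  u @ \oo --> x -> v @ \oo --> y ->
  (fun n => inner (u n) (v n)) @ \oo --> inner x y.
Proof.
have polar (w z : H) :
    inner w z = 2^-1 * (`|w + z| ^+ 2 - `|w| ^+ 2 - `|z| ^+ 2).
  by rewrite sqr_normD; field.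
move=> ux vy; rewrite polar; under eq_fun do rewrite polar.
have cvg_sqr (w : nat -> H) z :
    w @ \oo --> z -> (fun n => `|w n| ^+ 2) @ \oo --> `|z| ^+ 2.
  by move=> wz; rewrite expr2; under eq_fun do rewrite expr2;
     apply: cvgM; exact: cvg_norm.
apply: cvgMr; apply: cvgB; first apply: cvgB; apply: cvg_sqr => //.
exact: cvgD.
Qed.

End InnerProduct.

(** * Sequences with geometrically decaying increments or distances *)

Section GeometricCauchy.
Context {R : realType} {V : completeNormedModType R}.

(** The increments form a normally convergent telescoping series, and the geometric sum bounds the
    total displacement. *)
Lemma geometric_cvg (u : nat -> V) (C q : R) : 0 <= q < 1 ->
  (forall n, `|u n.+1 - u n| <= C * q ^+ n) ->
  exists2 l, u @ \oo --> l & `|l - u 0%N| <= C / (1 - q).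
Proof.
move=> /andP[q0 q1] uq.
have C0 : 0 <= C by have := uq 0%N; rewrite expr0 mulr1; exact: le_trans.
have qn : `|q| < 1 by rewrite ger0_norm.
pose t : nat -> V := telescope u.
have tq : cvgn [normed series t].
  have gC n : 0 <= geometric C q n.
    by rewrite /geometric /= mulr_ge0 // exprn_ge0.
  by apply: (series_le_cvg _ gC uq) (is_cvg_geometric_series qn) => n.
have tE n : series t n = u n - u 0%N by rewrite /t telescopeK.
have [l tl] : exists l : V, series t @ \oo --> l.
  by exists (limn (series t)); exact: normed_cvg.
exists (l + u 0%N).
  have uE : u = (fun n => series t n + u 0%N).
    by apply/funext => n; rewrite tE subrK.
  rewrite [X in X @ _]uE.
  exact: cvgD tl (cvg_cst _).
rewrite addrK.
have nl : (fun n => `|series t n|) @ \oo --> `|l| by apply: cvg_norm.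
rewrite -(cvg_lim (@Rhausdorff R) nl); apply: limr_le; first by apply: cvgP nl.
apply: nearW => n; apply: le_trans (ler_norm_sum _ _ _) _.
apply: (@le_trans _ _ (series (geometric C q) n)).
  by apply: ler_sum => i _; exact: uq.
rewrite geometric_seriesE ?lt_eqF //= ler_pM2r ?invr_gt0 ?subr_gt0 //.
by rewrite ler_piMr // lerBlDr lerDl exprn_ge0.
Qed.

Lemma cvg_dist_geometric (u : nat -> V) l (C q : R) : 0 <= q < 1 ->
  (forall n, `|u n - l| <= C * q ^+ n) -> u @ \oo --> l.
Proof.
move=> /andP[q0 q1] ul; apply/subr_cvg0/norm_cvg0P.
apply: (@squeeze_cvgr _ _ _ _ (fun=> 0) (geometric C q)).
- by apply: nearW => n; rewrite normr_ge0 ul.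
- exact: cvg_cst.
- by apply: cvg_geometric; rewrite ger0_norm.
Qed.

Lemma cvg_sqr_dist_geometric (u : nat -> V) l (C q : R) : 0 <= q < 1 ->
  (forall n, `|u n - l| ^+ 2 <= C * q ^+ n) -> u @ \oo --> l.
Proof.
move=> /andP[q0 q1] ul.
have C0 : 0 <= C.
  by have := ul 0%N; rewrite expr0 mulr1; apply: le_trans; exact: sqr_ge0.
apply: (@cvg_dist_geometric _ _ (Num.sqrt C) (Num.sqrt q)).
  by rewrite sqrtr_ge0 -[ltRHS]sqrtr1 ltr_sqrt.
move=> n; rewrite -(@ler_pXn2r _ 2) ?nnegrE ?mulr_ge0 ?exprn_ge0 ?sqrtr_ge0 //.
by rewrite exprMn exprAC !sqr_sqrtr.
Qed.

End GeometricCauchy.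

(** * A variational principle with a quadratic perturbation *)

Section Variational.
Context {R : realType} {H : hilbertType R}.
Implicit Types (g : H -> \bar R) (w q : H) (s r : R).

(** A real strictly between [r] and [g q] would, by semicontinuity, separate [g (u n)] from [c n]
    for large [n]. *)
Lemma lsc_closed_epi g (u : nat -> H) (c : nat -> R) q r :
  lower_semicontinuous g -> u @ \oo --> q -> c @ \oo --> r ->
  (forall n, g (u n) <= (c n)%:E)%E -> (g q <= r%:E)%E.
Proof.
move=> glsc uq cr guc; rewrite leNgt; apply/negP => rg.
have [a ra ag] : exists2 a, r < a & (a%:E < g q)%E.
  case: (g q) rg => [b| |] //; last by exists (r + 1); rewrite ?ltrDl ?ltry.
  by rewrite lte_fin => rb; exists ((r + b) / 2); rewrite ?lte_fin; lra.
have [U Uq Ug] := glsc _ _ ag.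
near \oo => n.
have cna : c n < a by near: n; exact: (cvgr_lt _ cr).
have /Ug : U (u n) by near: n; exact: uq.
by rewrite ltNge (le_trans (guc n)) // lee_fin ltW.
Unshelve. all: by end_near. Qed.

Lemma epi_near_min (E : H -> R -> Prop) (Q : H -> R) (m e : R) : 0 < e ->
  (exists w s, E w s) ->
  (forall w s, E w s -> m <= s + Q w) ->
  exists p : H * R, E p.1 p.2 /\
    forall w s, E w s -> p.2 + Q p.1 <= s + Q w + e.
Proof.
move=> e0 [w0 [s0 ws0]] mQ.
pose A := [set p.2 + Q p.1 | p in [set p : H * R | E p.1 p.2]].
have Alb : has_lbound A by exists m => _ [[w s] /= ws <-]; exact: mQ.
have Ainf : has_inf A by split => //; exists (s0 + Q w0); exists (w0, s0).
have [_ [p gp <-] pA] := inf_adherent e0 Ainf.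
exists p; split => // w s ws; apply: le_trans (ltW pA) _.
by rewrite lerD2r; apply: ge_inf => //; exists (w, s).
Qed.

(* [E] plays the role of an epigraph.  [q] is the limit of approximate
   minimizers [x n] over [E] of [s + S n / 2 * |w|^2 - <Y n, w>]; up to a
   constant, each step adds [(S n.+1 - S n) / 2 * |w - x n|^2], which forces [x]
   to be Cauchy. *)
Lemma smooth_variational (E : H -> R -> Prop) (c : R) : 0 < c ->
  (forall (u : nat -> H) (d : nat -> R) q r, u @ \oo --> q -> d @ \oo --> r ->
    (forall n, E (u n) (d n)) -> E q r) ->
  (forall w s t, E w s -> s <= t -> E w t) ->
  (exists w s, E w s) ->
  (forall v, exists m, forall w s, E w s -> m <= s - inner v w) ->
  exists q v, `|v| <= c /\ forall w s, E w s ->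
    E q (s + inner v (w - q) + c / 2 * `|w - q| ^+ 2).
Proof.
move=> c0 Ecl Eup Edom Ebnd.
pose h : R := 2^-1.
have h0 n : 0 < h ^+ n by rewrite exprn_gt0 // invr_gt0.
have h01 : 0 <= h < 1 by rewrite /h; lra.
have h1 n : h ^+ n <= 1 by case/andP: h01 => *; rewrite exprn_ile1 // ltW.
pose S n := c * (1 - h ^+ n).
have S_ge0 n : 0 <= S n by rewrite mulr_ge0 ?subr_ge0 ?h1 ?(ltW c0).
have S_lec n : S n <= c by rewrite ger_pMr // gerBl ltW.
(* In [xS] two near-minimality inequalities add up to [c p / 2 * |x n.+1 - x n|^2 <= e n + e n.+1 <=
   2 e n] with [p = h ^+ n.+1]; this choice of [e n] yields [|x n.+1 - x n| <= p]. *)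
pose e n := c / 4 * (h ^+ n.+1) ^+ 3.
have e0 n : 0 < e n by apply: mulr_gt0; [exact: divr_gt0|exact/exprn_gt0/h0].
(* [Y n.+1] depends on [x n], itself picked from [Y n]; choosing for all pairs at once makes the
   recursion definable. *)
have /choice [pick pickP] : forall nY : nat * H, exists p : H * R,
    E p.1 p.2 /\ forall w s, E w s ->
    p.2 + (S nY.1 / 2 * `|p.1| ^+ 2 - inner nY.2 p.1)
    <= s + (S nY.1 / 2 * `|w| ^+ 2 - inner nY.2 w) + e nY.1.
  move=> [n Y] /=; have [m mY] := Ebnd Y.
  apply: (@epi_near_min E (fun w => S n / 2 * `|w| ^+ 2 - inner Y w) m) => //.
  move=> w s ws.
  apply: le_trans (mY _ _ ws) _; rewrite lerD2l lerDr.
  by rewrite mulr_ge0 ?divr_ge0 ?exprn_ge0.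
pose Y n := iteri n (fun m Ym => Ym + (S m.+1 - S m) *: (pick (m, Ym)).1) 0.
pose x n := (pick (n, Y n)).1; pose r n := (pick (n, Y n)).2.
have Exr n : E (x n) (r n) by have [] := pickP (n, Y n).
have YS n : Y n.+1 = Y n + (S n.+1 - S n) *: x n by [].
have xmin n w s : E w s ->
    r n + (S n / 2 * `|x n| ^+ 2 - inner (Y n) (x n))
    <= s + (S n / 2 * `|w| ^+ 2 - inner (Y n) w) + e n.
  by have [_] := pickP (n, Y n); apply.
have xS n : `|x n.+1 - x n| <= 2^-1 * h ^+ n.
  have := lerD (xmin n _ _ (Exr n.+1)) (xmin n.+1 _ _ (Exr n)).
  rewrite YS -!inner_norm !innerE => hn.
  have eS : e n.+1 <= e n.
    rewrite ler_pM2l ?divr_gt0 // ler_pXn2r ?nnegrE ?(ltW (h0 _)) //.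
    by rewrite (exprS _ n.+1) ger_pMl // /h; lra.
  rewrite -exprS -(@ler_pXn2r _ 2) ?nnegrE ?(ltW (h0 _)) //.
  rewrite -inner_norm !innerE.
  have p0 := h0 n.+1; have eE : e n = c / 4 * (h ^+ n.+1) ^+ 3 by [].
  have SE : S n.+1 - S n = c * h ^+ n.+1.
    by rewrite /S (exprS _ n) /h; field.
  move: eS eE hn SE; rewrite (innerC (x n.+1) (x n)).
  set p := h ^+ n.+1 in p0 *; move=> eS eE hn SE.
  rewrite -(@ler_pM2l _ (c * p / 2)) ?divr_gt0 ?mulr_gt0 //.
  have {}SE : S n.+1 = S n + c * p by lra.
  rewrite SE in hn *.
  lra.
have [q xq _] := @geometric_cvg R H x 2^-1 h h01 xS.
(* [V n] is the gradient at [x n] of the perturbation [S n / 2 * |w|^2 - <Y n, w>]; its limit is the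
   slope [v]. *)
pose V n := S n *: x n - Y n.
have VS n : `|V n.+1 - V n| <= c / 2 * h ^+ n.
  rewrite /V YS.
  have -> : S n.+1 *: x n.+1 - (Y n + (S n.+1 - S n) *: x n)
      - (S n *: x n - Y n)
      = S n.+1 *: (x n.+1 - x n).
    rewrite scalerBl scalerBr.
    move: (S n.+1 *: _) (S n.+1 *: _) (S n *: _) => a b d.
    by rewrite opprD !opprB !addrA (ACl (1*4*(2*5)*(3*6)))/= subrr addNr !addr0.
  rewrite normrZ ger0_norm //; apply: le_trans (_ : c * (2^-1 * h ^+ n) <= _).
    by apply: ler_pM.
  by rewrite mulrA.
have [v Vv vc] := @geometric_cvg R H V (c / 2) h h01 VS.
exists q, v; split.
  have V0 : V 0%N = 0 by rewrite /V /S expr0 subrr mulr0 scale0r subrr.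
  rewrite -(subr0 v) -V0; apply: le_trans vc _.
  have -> : 1 - h = 2^-1 by rewrite /h; lra.
  by rewrite invrK divfK.
move=> w s ws.
(* Near-minimality expanded around [x n], with [S n] enlarged to [c] and [e n] to [c h^n], is a
   membership in [E] that passes to the limit. *)
apply: (Ecl x (fun n => s + inner (V n) (w - x n) +
   c / 2 * `|w - x n| ^+ 2 + geometric c h n)) => //.
  rewrite -[X in _ --> X]addr0; apply: cvgD; last first.
    by apply: cvg_geometric; case/andP: h01 => ? ?; rewrite ger0_norm.
  have wx : (fun n => w - x n) @ \oo --> w - q.
    by apply: cvgB xq; exact: cvg_cst.
  apply: cvgD; first by apply: cvgD; [exact: cvg_cst|exact: cvg_inner].
  by rewrite -inner_norm; under eq_fun do rewrite -inner_norm;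
    apply: cvgMr; exact: cvg_inner.
move=> n; apply: Eup (Exr n) _.
have eS : e n <= c * h ^+ n.
  rewrite /e -mulrA ler_pM2l // -exprM; case/andP: h01 => ? /ltW ?.
  apply: le_trans (_ : h ^+ (n.+1 * 3) <= _).
    by rewrite ler_piMl ?exprn_ge0 //; lra.
  by apply: ler_wiXn2l => //; apply: leq_trans (leqnSn n) _; rewrite leq_pmulr.
have := xmin n w s ws.
have : 0 <= (c - S n) / 2 * `|w - x n| ^+ 2.
  by rewrite mulr_ge0 ?exprn_ge0 ?divr_ge0 ?subr_ge0.
rewrite /V /geometric /= -!inner_norm !innerE (innerC w (x n)) => ? ?.
lra.
Qed.

End Variational.

(** * Strong monotonicity of the subdifferential *)

Section Subdifferential.
Context {R : realType} {H : hilbertType R} (g : H -> \bar R).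
Context (g_proper : proper_fun g).
Implicit Types (u v w q z : H) (s r c : R).

Lemma proper_epi_nonempty : exists w s, (g w <= s%:E)%E.
Proof.
have [gN [w gw]] := g_proper; exists w, (fine (g w)).
by rewrite fineK // fin_numE gN lt_eqF.
Qed.

Lemma fin_num_le_epi q : (exists s, g q <= s%:E)%E -> g q \is a fin_num.
Proof.
move=> [s qs]; rewrite fin_numE g_proper.1 /= lt_eqF //.
exact: le_lt_trans qs (ltry _).
Qed.

(** Real upper bounds [s] of [g w] replace extended-real arithmetic; points where [g] is [+oo] have
    none. *)
Lemma subdifferentialP q u : subdifferential g q u <->
  forall w s, (g w <= s%:E)%E -> (g q <= (s - inner u (w - q))%:E)%E.
Proof.
split=> [qu w s ws | qu w].
  by rewrite EFinB leeBrDl // (le_trans (qu w)).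
case gw : (g w) => [s| |]; last 2 first.
- by rewrite leey.
- by have := g_proper.1 w; rewrite gw.
have := qu w s; rewrite gw lexx => /(_ isT).
by rewrite EFinB leeBrDl.
Qed.

Lemma subdifferential_fin q u : subdifferential g q u -> g q \is a fin_num.
Proof.
move=> /subdifferentialP qu; have [w [s ws]] := proper_epi_nonempty.
by apply: fin_num_le_epi; exists (s - inner u (w - q)); exact: qu.
Qed.

Context (mu : R) (g_sconvex : strongly_convex mu g).

Lemma strongly_convex_epi q u w s : subdifferential g q u ->
  (g w <= s%:E)%E ->
  (g q <= (s - inner u (w - q) - mu / 2 * `|w - q| ^+ 2)%:E)%E.
Proof.
move=> qu ws; have h := le_trans (g_sconvex w qu) ws.
by rewrite -addrA -opprD EFinB leeBrDl // EFinD.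
Qed.

(** Each strong convexity inequality is taken at the other point; in the sum the values of [g]
    cancel and [mu / 2] doubles. *)
Lemma subdifferential_strong_monotone q q' u u' :
  subdifferential g q u -> subdifferential g q' u' ->
  mu * `|q - q'| ^+ 2 <= inner (u - u') (q - q').
Proof.
move=> qu qu'; have gq := subdifferential_fin qu.
have gq' := subdifferential_fin qu'.
have := strongly_convex_epi (w := q') (s := fine (g q')) qu.
have := strongly_convex_epi (w := q) (s := fine (g q)) qu'.
rewrite -[g q](fineK gq) -[g q'](fineK gq') /= !lexx.
move=> /(_ isT) + /(_ isT); rewrite !lee_fin -!inner_norm !innerE => ? ?; lra.
Qed.

Lemma subdifferential_inv_lipschitz q q' u u' :
  subdifferential g q u -> subdifferential g q' u' ->
  mu * `|q - q'| <= `|u - u'|.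
Proof.
move=> qu qu'.
have [->|qq'] := eqVneq (q - q') 0; first by rewrite normr0 mulr0.
have d0 : 0 < `|q - q'| by rewrite normr_gt0.
rewrite -(ler_pM2r d0) -mulrA -expr2.
exact: le_trans (subdifferential_strong_monotone qu qu') (inner_le_norm _ _).
Qed.

End Subdifferential.

(** * Surjectivity of the subdifferential, resolvents and proximal points *)

Section Surjectivity.
Context {R : realType} {H : hilbertType R} (g : H -> \bar R) (mu : R).
Context (g_proper : proper_fun g) (g_lsc : lower_semicontinuous g).
Context (mu_gt0 : 0 < mu) (g_sconvex : strongly_convex mu g).
Context (x0 u0 : H) (g_base : subdifferential g x0 u0).
Implicit Types (u v w p q z : H) (s r c : R).

(* The variational principle is applied to [g - <u, .> - c/2 |. - x0|^2]: its
   concave term cancels the quadratic perturbation, leaving an affine minorant. *)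
Lemma subdifferential_dense u (e : R) : 0 < e ->
  exists q v, subdifferential g q v /\ `|v - u| <= e.
Proof.
move=> e0.
(* [M] is the a priori bound on [|q - x0|] given by the inverse Lipschitz estimate against the base
   point, once [c <= mu / 2]; then [c (1 + M) <= e] controls the error. *)
pose M : R := 1 + 2 * `|u - u0| / mu.
have M0 : 0 < M by rewrite ltr_pwDl // divr_ge0 ?mulr_ge0 ?(ltW mu_gt0).
pose c : R := Num.min (mu / 2) (e / (1 + M)).
have c0 : 0 < c by rewrite lt_min !divr_gt0 // addr_gt0.
have cmu : c <= mu / 2 by rewrite ge_min lexx.
have ce : c * (1 + M) <= e.
  have M1 : 0 < 1 + M by exact: addr_gt0.
  rewrite -(ler_pdivlMr _ _ M1); by rewrite ge_min lexx orbT.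
pose E w s := (g w <= (s + inner u w + c / 2 * `|w - x0| ^+ 2)%:E)%E.
have [||||q [v [vc qmin]]] := @smooth_variational R H E c c0.
- move=> y d q r yq dr yE; apply: lsc_closed_epi (g_lsc) (yq) _ yE.
  apply: cvgD; first by apply: cvgD => //; exact: cvg_inner (cvg_cst _) yq.
  have yx : (fun n => y n - x0) @ \oo --> q - x0.
    by apply: cvgB => //; exact: cvg_cst.
  by rewrite -inner_norm; under eq_fun do rewrite -inner_norm;
    apply: cvgMr; exact: cvg_inner.
- by move=> w s t ws st; apply: le_trans ws _; rewrite lee_fin -!addrA lerD2r.
- have [w [s ws]] := proper_epi_nonempty g_proper.
  exists w, (s - inner u w - c / 2 * `|w - x0| ^+ 2); rewrite /E.
  by move: ws; congr (is_true (_ <= _%:E)%E); ring.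
- move=> v; have gx0 := subdifferential_fin g_proper g_base.
  (* Boundedness below: strong convexity at [x0] supplies [mu / 2 * |w - x0|^2]; Young spends
     [mu / 4] on the linear term [p], and the concave term takes [c / 2 <= mu / 4]. *)
  pose p := u + v - u0.
  exists (fine (g x0) - inner (u + v) x0 - `|p| ^+ 2 / mu) => w s ws.
  have := strongly_convex_epi g_sconvex g_base ws.
  rewrite -[g x0](fineK gx0) /= lee_fin.
  have := inner_young p (w - x0) (divr_gt0 (ltr0Sn _ 1) mu_gt0).
  have : 0 <= (mu / 2 - c) / 2 * `|w - x0| ^+ 2.
    by rewrite mulr_ge0 ?exprn_ge0 ?divr_ge0 ?subr_ge0.
  rewrite invf_div.
  have -> : inner (u + v) x0 = inner (u + v) w - inner (u + v) (w - x0).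
    by rewrite !innerE; ring.
  have -> : inner p (w - x0) = inner (u + v) (w - x0) - inner u0 (w - x0).
    by rewrite /p innerDl innerNl.
  rewrite (innerDl u v w).
  move: (`|w - x0| ^+ 2) (`|p| ^+ 2) => D P; lra.
have qv : subdifferential g q (u - v + c *: (q - x0)).
  apply/(subdifferentialP g_proper) => w s ws.
  have := qmin w (s - inner u w - c / 2 * `|w - x0| ^+ 2).
  rewrite /E (_ : _ + inner u w + _ = s); last by ring.
  move=> /(_ ws); congr (is_true (_ <= _%:E)%E).
  rewrite -!inner_norm !innerE (innerC w q) (innerC w x0) (innerC q x0).
  by field.
exists q, (u - v + c *: (q - x0)); split => //.
have nv : `|u - v + c *: (q - x0) - u| <= c * (1 + `|q - x0|).
  rewrite (_ : _ - u = - v + c *: (q - x0)); last first.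
    by rewrite addrAC (addrAC u) subrr add0r.
  apply: le_trans (ler_normD _ _) _.
  by rewrite normrN normrZ gtr0_norm // mulrDr mulr1 lerD2r.
apply: le_trans (nv) _; apply: le_trans ce; rewrite ler_pM2l // lerD2l.
have := subdifferential_inv_lipschitz g_proper g_sconvex qv g_base.
set v' := _ + c *: _ in nv *; move=> lip.
have mu_d : mu * `|q - x0| <= c * (1 + `|q - x0|) + `|u - u0|.
  by apply: le_trans lip _; apply: le_trans (ler_distD u _ _) _; rewrite lerD2r.
rewrite -(ler_pM2l mu_gt0) /M mulrDr mulr1 (mulrC mu (_ / mu)) divfK ?gt_eqF //.
have : c * (1 + `|q - x0|) <= mu / 2 * (1 + `|q - x0|).
  by rewrite ler_pM2r // ltr_pwDl.
lra.
Qed.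

(** Approximate solutions with error [h ^+ n] are Cauchy by the inverse Lipschitz bound, and
    semicontinuity passes the subgradient inequality to the limit. *)
Lemma subdifferential_surjective u : exists q, subdifferential g q u.
Proof.
pose h : R := 2^-1.
have h0 n : 0 < h ^+ n by rewrite exprn_gt0 // invr_gt0.
have h01 : 0 <= h < 1 by rewrite /h; lra.
have /choice [q_ /choice [v_ /all_and2 [qv vu]]] : forall n, exists q, exists v,
    subdifferential g q v /\ `|v - u| <= h ^+ n.
  by move=> n; exact: subdifferential_dense.
have qS n : `|q_ n.+1 - q_ n| <= 2 / mu * h ^+ n.
  have := subdifferential_inv_lipschitz g_proper g_sconvex (qv n.+1) (qv n).
  have := ler_distD u (v_ n.+1) (v_ n); rewrite (distrC u).
  rewrite mulrAC ler_pdivlMr // (mulrC _ mu) => ? ?.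
  have := vu n; have := vu n.+1; have : h ^+ n.+1 <= h ^+ n.
    by rewrite exprS ger_pMl // /h; lra.
  lra.
have [q qq _] := geometric_cvg h01 qS.
exists q; apply/(subdifferentialP g_proper) => w s ws.
apply: (lsc_closed_epi (c := fun n => s - inner (v_ n) (w - q_ n)) g_lsc qq).
  apply: cvgB; first exact: cvg_cst.
  apply: cvg_inner; last by apply: cvgB => //; exact: cvg_cst.
  by apply: (@cvg_dist_geometric _ _ _ _ 1 h) => // n; rewrite mul1r.
by move=> n; exact: (subdifferentialP g_proper _ _).1.
Qed.

(** The unknown is the subgradient [u], not the point: with [X] a selection of the inverse
    subdifferential, one solves [t u + X u = z] as a fixed-point problem. *)
Lemma subdifferential_resolvent z (t : R) : 0 < t ->
  exists q, subdifferential g q (t^-1 *: (z - q)).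
Proof.
move=> t0; have /choice [X uX] := subdifferential_surjective.
pose rho := (1 + 2 * mu * t)^-1.
(* With this [d], cocoercivity of [X] absorbs [d ^+ 2 * |X u - X v|^2] in
   [|T u - T v|^2]. *)
pose d := 2 * mu * rho.
pose T u := rho *: u - d *: X u + d *: z.
have t1 : 0 < 1 + 2 * mu * t by rewrite ltr_pwDl // !mulr_ge0 // ltW.
have rho0 : 0 < rho by rewrite invr_gt0.
have d0 : 0 < d by rewrite !mulr_gt0.
(* This identity turns [u = T u] into [t u = z - X u]. *)
have rhoE : 1 - rho = d * t by rewrite /d /rho; field; rewrite gt_eqF.
have rho1 : rho < 1 by rewrite -subr_gt0 rhoE mulr_gt0.
have Tlip u v : `|T u - T v| <= rho * `|u - v|.
  have -> : T u - T v = rho *: (u - v) - d *: (X u - X v).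
    rewrite /T opprD addrACA subrr addr0 !scalerBr !opprB.
    by rewrite !addrA (ACl (1*4*3*2)).
  rewrite -(@ler_pXn2r _ 2) ?nnegrE ?mulr_ge0 ?(ltW rho0) //.
  have mon := subdifferential_strong_monotone g_proper g_sconvex (uX u) (uX v).
  rewrite sqr_normB !normrZ !gtr0_norm // !exprMn innerZl innerZr.
  rewrite (innerC (u - v)) in mon *.
  have : 0 <= 2 * rho * d *
      (inner (X u - X v) (u - v) - mu * `|X u - X v| ^+ 2).
    apply: mulr_ge0; last by rewrite subr_ge0.
    exact: ltW (mulr_gt0 (mulr_gt0 _ _) _).
  rewrite /d; lra.
have [u uT] : exists u, u = T u.
  pose f : {fun setT >-> setT} := totalfun T.
  have fc : is_contraction f.
    by exists (NngNum (ltW rho0)); split => // -[u v] _; exact: Tlip.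
  have [||p _ pf] := banach_fixed_point fc; first exact: closedT.
    by exists 0.
  by exists p.
exists (X u).
suff -> : t^-1 *: (z - X u) = u by [].
apply: (scalerI (lt0r_neq0 t0)); rewrite scalerA divff ?gt_eqF // scale1r.
apply: (scalerI (lt0r_neq0 d0)); rewrite scalerA -rhoE scalerBl scale1r.
by apply/esym; rewrite {1}uT /T addrC !addrA addNr add0r scalerBr addrC.
Qed.

(** Minimality of [p] is played against strong convexity at the resolvent solution [q]; together
    they force [p = q]. *)
Lemma Prox_subdifferential z p (t : R) : 0 < t ->
  Prox (fun w => t%:E * g w)%E z p -> subdifferential g p (t^-1 *: (z - p)).
Proof.
move=> t0 pP; have [q qz] := subdifferential_resolvent z t0.
suff -> : p = q by [].
have gq := subdifferential_fin g_proper qz.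
have := pP q; rewrite -[g q](fineK gq) -EFinM -EFinD.
case gp : (g p) => [r| |]; last 2 first.
- by rewrite gt0_muley ?lte_fin // addye.
- by have := g_proper.1 p; rewrite gp.
rewrite -EFinM -EFinD lee_fin => pq.
have := strongly_convex_epi g_sconvex qz (s := r) (w := p).
rewrite gp lexx => /(_ isT); rewrite -[g q](fineK gq) lee_fin /= innerZl.
rewrite -(ler_pM2l t0) !mulrBr mulrA divff ?gt_eqF // mul1r => qp.
have D0 : (t * mu + 1) / 2 * `|p - q| ^+ 2 <= 0.
  have zpE : z - p = (z - q) - (p - q) by rewrite opprB addrA subrK.
  move: pq; rewrite zpE sqr_normB; lra.
apply/eqP; rewrite -subr_eq0 -normr_eq0 -sqrf_eq0 eq_le sqr_ge0 andbT.
rewrite -(pmulr_rle0 _ (_ : 0 < (t * mu + 1) / 2)) //.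
by rewrite divr_gt0 // addr_gt0 ?mulr_gt0.
Qed.

End Surjectivity.

(** * Operator norm bound and optimality conditions at a saddle point *)

Section SaddlePoints.
Context {R : realType} {H1 H2 : hilbertType R}.

(** Continuity bounds the set in [opnorm], so that [sup] is an upper bound; it is used at the
    normalized vector. *)
Lemma opnorm_le (K : {linear H1 -> H2}) u : continuous K ->
  `|K u| <= opnorm K * `|u|.
Proof.
move=> /linear_bounded_continuous/linear_boundedP Kb.
have [M M0 KM] : exists2 M : R, 0 <= M & forall w, `|K w| <= M * `|w|.
  near +oo_R => M; exists M; first by near: M; exact: nbhs_pinfty_ge.
  by near: M.
have [->|u0] := eqVneq u 0; first by rewrite linear0 !normr0 mulr0.
have nu : 0 < `|u| by rewrite normr_gt0.
rewrite -ler_pdivrMr //; apply: ub_le_sup.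
  by exists M => _ [w w1 <-]; apply: le_trans (KM w) _; rewrite ler_piMr.
exists (`|u|^-1 *: u); rewrite /= ?linearZ /= normrZ ger0_norm ?invr_ge0 //.
  by rewrite mulVf ?gt_eqF.
by rewrite mulrC.
Unshelve. all: by end_near. Qed.

Lemma saddle_point_subdifferential (K : {linear H1 -> H2}) (Kstar : H2 -> H1)
    (g : H1 -> \bar R) (h : H2 -> \bar R) (xs : H1) (ys : H2) :
  is_adjoint K Kstar -> proper_fun g -> proper_fun h ->
  saddle_point (lagrangian K g h) xs ys ->
  subdifferential g xs (- Kstar ys) /\ subdifferential h ys (K xs).
Proof.
move=> KK [gN [xg gxg]] [hN [yh hyh]] sad.
have gxgf : g xg \is a fin_num by rewrite fin_numE gN lt_eqF.
have hyhf : h yh \is a fin_num by rewrite fin_numE hN lt_eqF.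
(* [h ys] comes first: if it were [+oo], the saddle value would be [-oo] even with [g xs = +oo], by
   the convention on [+oo - +oo]. Finiteness of [g xs] then uses that of [h ys]. *)
have hys : h ys \is a fin_num.
  have [+ _] := sad xg yh; rewrite /lagrangian fin_numE hN /=.
  rewrite -(fineK hyhf); apply: contraTneq => ->.
  by case: (g xs) (gN xs).
have gxs : g xs \is a fin_num.
  have [_] := sad xg yh; rewrite /lagrangian fin_numE gN /=.
  rewrite -(fineK hys) -(fineK gxgf); apply: contraTneq => ->.
  by [].
split=> [x | y].
- have [_] := sad x yh; rewrite /lagrangian -(fineK hys) -(fineK gxs).
  case: (g x) (gN x) => [r| |] //; last by move=> _ _; exact: leey.
  move=> _.
  rewrite -!(EFinD, EFinB) !lee_fin innerNl innerDr innerNr.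
  rewrite !(innerC (Kstar ys)) -!KK; lra.
- have [+ _] := sad xg y; rewrite /lagrangian -(fineK hys) -(fineK gxs).
  case: (h y) (hN y) => [r| |] //; last by move=> _ _; exact: leey.
  move=> _.
  rewrite -!(EFinD, EFinB) !lee_fin innerDr innerNr; lra.
Qed.

End SaddlePoints.

(** * One-step decrease of the energy *)

Section Energy.
Context {R : realType} {H1 H2 : hilbertType R} (K : {linear H1 -> H2}).
Context (tau sigma alpha beta mu nu L : R).
Context (tau_gt0 : 0 < tau) (alpha_gt0 : 0 < alpha).
Context (K_le : forall u, `|K u| <= L * `|u|).

Definition apmm_energy (a f : H1) (b : H2) : R :=
  tau^-1 * `|a| ^+ 2 + sigma^-1 * `|b| ^+ 2 + 2 * alpha * inner (K f) b
  + alpha / tau * `|f| ^+ 2.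

Lemma sqr_norm_le u : `|K u| ^+ 2 <= L ^+ 2 * `|u| ^+ 2.
Proof.
by rewrite -exprMn ler_pXn2r ?nnegrE // (le_trans _ (K_le u)).
Qed.

(** [d] and [e] are the errors of the new iterates. In twice the sum of the last two hypotheses,
    [<K (d - a), e>] joins the new energy and [alpha <K f, b>] the old one. Young bounds the
    remaining [alpha <K f, e - b>] and [beta <K d, e - b>]; their [|e - b|^2] parts are paid by
    [sigma^-1 * |e - b|^2]. *)
Lemma apmm_energy_decrease (eta1 eta3 : R) (a d f : H1) (b e : H2) :
  0 < eta1 -> 0 < eta3 ->
  (alpha * tau)^-1 + L ^+ 2 * beta ^+ 2 * eta3 <= 2 * mu + tau^-1 ->
  (alpha * sigma)^-1 <= 2 * nu + sigma^-1 ->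
  eta1^-1 + eta3^-1 <= sigma^-1 ->
  alpha * tau * eta1 * L ^+ 2 <= 1 ->
  mu * `|d| ^+ 2 <=
    tau^-1 * inner (a - d) d - inner (K d) (e + beta *: (e - b)) ->
  nu * `|e| ^+ 2 <=
    sigma^-1 * inner (b - e) e + inner (K (a + alpha *: f)) e ->
  apmm_energy d (d - a) e <= alpha * apmm_energy a f b.
Proof.
move=> eta1_gt0 eta3_gt0 hmu hnu heta hL gd he.
rewrite -ler_pdivrMl // /apmm_energy.
have Y1 := inner_young (alpha *: K f) (e - b) eta1_gt0.
have Y3 := inner_young (- beta *: K d) (e - b) eta3_gt0.
rewrite normrZ exprMn in Y1; rewrite normrZ exprMn in Y3.
rewrite real_normK ?num_real // in Y1; rewrite real_normK ?num_real // in Y3.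
have F1 := ler_wpM2l (ltW (mulr_gt0 eta1_gt0 (exprn_gt0 2 alpha_gt0)))
  (sqr_norm_le f).
have F3 := ler_wpM2l (mulr_ge0 (ltW eta3_gt0) (sqr_ge0 beta)) (sqr_norm_le d).
have G1 := ler_wpM2r (sqr_ge0 `|d|) hmu.
have G2 := ler_wpM2r (sqr_ge0 `|e|) hnu.
have G3 := ler_wpM2r (sqr_ge0 `|e - b|) heta.
have G4 := ler_wpM2r
  (mulr_ge0 (ltW (divr_gt0 alpha_gt0 tau_gt0)) (sqr_ge0 `|f|)) hL.
(* So the [|f|^2] part of Young with weight [eta1] is at most the term [alpha / tau * |f|^2] of the
   old energy. *)
have tE : alpha * tau * eta1 * L ^+ 2 * (alpha / tau * `|f| ^+ 2) =
  alpha ^+ 2 * eta1 * L ^+ 2 * `|f| ^+ 2 by field; rewrite gt_eqF.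
rewrite {}tE in G4.
have E1 : alpha^-1 * (tau^-1 * `|d| ^+ 2) = (alpha * tau)^-1 * `|d| ^+ 2.
  by rewrite invfM; ring.
have E2 : alpha^-1 * (sigma^-1 * `|e| ^+ 2) = (alpha * sigma)^-1 * `|e| ^+ 2.
  by rewrite invfM; ring.
have E3 : alpha^-1 * (2 * alpha * inner (K (d - a)) e) =
    2 * inner (K (d - a)) e.
  by field; rewrite gt_eqF.
have E4 : alpha^-1 * (alpha / tau * `|d - a| ^+ 2) = tau^-1 * `|d - a| ^+ 2.
  by field; rewrite !gt_eqF.
rewrite !mulrDr E1 E2 E3 E4.
move: gd he Y1 Y3 F1 F3 G1 G2 G3 G4 {E1 E2 E3 E4}.
rewrite -!inner_norm !linearD !linearN !linearZ !innerE /=.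
rewrite (innerC d a) (innerC e b).
move: (alpha * tau)^-1 (alpha * sigma)^-1 => i1 i2 *.
lra.
Qed.

End Energy.

(** * Linear convergence of the method *)

Theorem corollary3p2 (R : realType) (H1 H2 : hilbertType R)
    (K : {linear H1 -> H2}) (Kstar : H2 -> H1)
    (g : H1 -> \bar R) (h : H2 -> \bar R) (mu nu : R)
    (xs : H1) (ys : H2)
    (tau sigma alpha beta eta1 eta2 eta3 eta4 : R)
    (x xbar : nat -> H1) (y ybar : nat -> H2)
    (K_continuous : continuous K)
    (K_adjoint : is_adjoint K Kstar)
    (g_proper : proper_fun g) (g_lsc : lower_semicontinuous g)
    (h_proper : proper_fun h) (h_lsc : lower_semicontinuous h)
    (mu_gt0 : 0 < mu) (nu_gt0 : 0 < nu)
    (g_sconvex : strongly_convex mu g)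
    (h_sconvex : strongly_convex nu h)
    (saddle : saddle_point (lagrangian K g h) xs ys)
    (tau_gt0 : 0 < tau) (sigma_gt0 : 0 < sigma)
    (alpha_gt0 : 0 < alpha) (beta_ge0 : 0 <= beta)
    (iterates : apmm K Kstar g h (fun=> tau) (fun=> sigma)
                     (fun=> alpha) (fun=> beta) x xbar y ybar)
    (K_tau : opnorm K ^+ 2 < (2 * mu + 1 / tau) / sigma)
    (K_sigma : opnorm K ^+ 2 < (2 * nu + 1 / sigma) / tau)
    (alpha_mu : 1 / (2 * mu * tau + 1) < alpha) (alpha_lt1 : alpha < 1)
    (alpha_nu : 1 / (2 * nu * sigma + 1) <= alpha)
    (alpha_K : alpha * tau * sigma * opnorm K ^+ 2 < 1)
    (beta_K : opnorm K ^+ 2 * beta ^+ 2 * sigma <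
              (2 * mu + 1 / tau - 1 / (alpha * tau)) *
              (1 - alpha * tau * sigma * opnorm K ^+ 2))
    (eta3_gt0 : 0 < eta3)
    (eta3_sigma : sigma / (1 - alpha * tau * sigma * opnorm K ^+ 2) < eta3)
    (eta3_K : opnorm K ^+ 2 * beta ^+ 2 * eta3 <=
              2 * mu + 1 / tau - 1 / (alpha * tau))
    (eta4_gt0 : 0 < eta4) (eta4_tau : tau <= eta4)
    (eta4_K : alpha * sigma * eta4 * opnorm K ^+ 2 < 1)
    (eta1_gt0 : 0 < eta1)
    (eta1_eta3 : sigma * eta3 / (eta3 - sigma) <= eta1)
    (eta1_K : alpha * tau * eta1 * opnorm K ^+ 2 < 1)
    (eta2_gt0 : 0 < eta2)
    (eta2_eta1 :
       tau / (alpha * (1 - alpha * tau * eta1 * opnorm K ^+ 2)) <= eta2) :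
  let D := 1 / tau * `|xs - x 0%N| ^+ 2 + 1 / sigma * `|ys - y 0%N| ^+ 2 in
  (forall k : nat,
     `|x k.+1 - xs| ^+ 2 <= alpha ^+ k.+1 * tau * D /\
     `|y k.+1 - ys| ^+ 2 <=
       alpha ^+ k.+1 * (1 / sigma - alpha * eta4 * opnorm K ^+ 2)^-1 * D) /\
  linear_cvg_sq x y xs ys alpha.
Proof.
move=> D; set L := opnorm K in alpha_K eta3_sigma eta3_K eta4_K eta1_K *.
have KL u : `|K u| <= L * `|u| by exact: opnorm_le.
(* The saddle point also provides the base subgradients from which surjectivity was derived. *)
have [gxs hys] :=
  saddle_point_subdifferential K_adjoint g_proper h_proper saddle.
have ymin k := Prox_subdifferential h_proper h_lsc nu_gt0 h_sconvex hys
  sigma_gt0 (apmm_y iterates k).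
have xmin k := Prox_subdifferential g_proper g_lsc mu_gt0 g_sconvex gxs
  tau_gt0 (apmm_x iterates k).
(* [0.-1 = 0] encodes the convention that the iterate of index -1 is [x 0]; hence the step term
   vanishes in [V 0]. *)
have xbarE k : xbar k = x k + alpha *: (x k - x k.-1).
  case: k => [|k]; last exact: (apmm_xbar iterates).
  by rewrite (apmm_xbar0 iterates) subrr scaler0 addr0.
pose V k := apmm_energy K tau sigma alpha (x k - xs) (x k - x k.-1) (y k - ys).
have hmu : (alpha * tau)^-1 + L ^+ 2 * beta ^+ 2 * eta3 <= 2 * mu + tau^-1.
  by move: eta3_K; rewrite !div1r; lra.
have hnu : (alpha * sigma)^-1 <= 2 * nu + sigma^-1.
  have n0 : 0 < 2 * nu * sigma + 1 by rewrite ltr_wpDl // !mulr_ge0 ?ltW.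
  have -> : 2 * nu + sigma^-1 = (2 * nu * sigma + 1) / sigma.
    by field; rewrite gt_eqF.
  rewrite invfM ler_pM2r ?invr_gt0 // -[leRHS]invrK lef_pV2 ?posrE ?invr_gt0 //.
  by rewrite -div1r.
have aK0 : 0 <= alpha * tau * sigma * L ^+ 2.
  by apply: mulr_ge0; [rewrite ltW // !mulr_gt0 | exact: sqr_ge0].
have eta3_gt : sigma < eta3.
  apply: le_lt_trans eta3_sigma; rewrite ler_pdivlMr ?subr_gt0 //.
  by rewrite ler_piMr ?gerBl // ltW.
(* The lower bound on [eta1] is [eta1^-1 <= sigma^-1 - eta3^-1], inverted. *)
have heta : eta1^-1 + eta3^-1 <= sigma^-1.
  have -> : sigma^-1 = (sigma * eta3 / (eta3 - sigma))^-1 + eta3^-1.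
    by field; rewrite subr_eq0 !gt_eqF.
  by rewrite lerD2r lef_pV2 // posrE divr_gt0 ?mulr_gt0 ?subr_gt0.
have Vstep k : V k.+1 <= alpha * V k.
  rewrite /V /= (_ : x k.+1 - x k = (x k.+1 - xs) - (x k - xs)); last first.
    by rewrite opprB addrA subrK.
  apply: (apmm_energy_decrease tau_gt0 alpha_gt0 KL eta1_gt0 eta3_gt0 hmu hnu
    heta).
  - exact: ltW.
  - have := subdifferential_strong_monotone g_proper g_sconvex (xmin k) gxs.
    move/le_trans; apply; rewrite (apmm_ybar iterates).
    rewrite opprK (addrC _ (Kstar ys)) innerDl innerZl !innerE.
    rewrite !(innerC (Kstar _)) -!K_adjoint !(linearB K) !innerE.
    rewrite (innerC xs (x k.+1)).
    by rewrite le_eqVlt; apply/orP; left; apply/eqP; field; rewrite gt_eqF.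
  - have := subdifferential_strong_monotone h_proper h_sconvex (ymin k) hys.
    move/le_trans; apply; rewrite xbarE; move: (x k - x k.-1) => f.
    have KZ u : K (u + alpha *: f) = K u + alpha *: K f.
      by rewrite linearD linearZ.
    rewrite !KZ (linearB K) !innerE (innerC ys (y k.+1)).
    by rewrite le_eqVlt; apply/orP; left; apply/eqP; field; rewrite gt_eqF.
have V0 : V 0%N = D.
  rewrite /V /apmm_energy /= subrr linear0 normr0 -(scale0r 0) innerZl.
  rewrite (distrC (x _)) (distrC (y _)) /D !div1r expr0n /=.
  by rewrite !mulr0 mul0r mulr0 !addr0.
have Vk k : V k <= alpha ^+ k * D.
  elim: k => [|k IH]; first by rewrite expr0 mul1r V0.
  by apply: le_trans (Vstep k) _; rewrite exprS -mulrA ler_pM2l.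
have c0 : 0 < 1 / sigma - alpha * eta4 * L ^+ 2.
  rewrite subr_gt0 ltr_pdivlMr //; apply: le_lt_trans eta4_K.
  by rewrite le_eqVlt; apply/orP; left; apply/eqP; ring.
(* Young with weight [eta4 >= tau] bounds the cross term so that its [|f|^2] part is covered by
   [alpha / tau * |f|^2]. *)
have Vge k : tau^-1 * `|x k - xs| ^+ 2 +
    (1 / sigma - alpha * eta4 * L ^+ 2) * `|y k - ys| ^+ 2 <= V k.
  rewrite /V /apmm_energy.
  move: (x k - x k.-1) (y k - ys) => f b.
  have Kfb : - inner (K f) b <= L * `|f| * `|b|.
    rewrite -innerNr; apply: le_trans (inner_le_norm _ _) _.
    by rewrite normrN ler_wpM2r.
  have amgm : 2 * (L * `|f| * `|b|) <=
      `|f| ^+ 2 / tau + eta4 * L ^+ 2 * `|b| ^+ 2.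
    have := sqr_ge0 (`|f| - eta4 * L * `|b|).
    rewrite -(ler_pM2r (_ : 0 < eta4^-1)) ?invr_gt0 // mul0r.
    have -> : (`|f| - eta4 * L * `|b|) ^+ 2 / eta4 = `|f| ^+ 2 / eta4
        - 2 * (L * `|f| * `|b|) + eta4 * L ^+ 2 * `|b| ^+ 2.
      by field; rewrite gt_eqF.
    have : `|f| ^+ 2 / eta4 <= `|f| ^+ 2 / tau.
      by rewrite ler_wpM2l ?sqr_ge0 // lef_pV2.
    lra.
  have := ler_wpM2l (ltW alpha_gt0) Kfb; have := ler_wpM2l (ltW alpha_gt0) amgm.
  rewrite div1r; lra.
have D0 : 0 <= D by rewrite addr_ge0 // mulr_ge0 ?sqr_ge0 ?divr_ge0 ?ltW.
have xk k : `|x k - xs| ^+ 2 <= alpha ^+ k * tau * D.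
  rewrite mulrAC -ler_pdivrMr // mulrC; apply: le_trans (Vk k).
  by apply: le_trans (Vge k); rewrite lerDl mulr_ge0 ?sqr_ge0 ?(ltW c0).
(* The energy dominates squared distances, and the positive coefficient of [|y k - ys|^2] in [Vge]
   enters as its inverse. *)
have yk k : `|y k - ys| ^+ 2 <=
    alpha ^+ k * (1 / sigma - alpha * eta4 * L ^+ 2)^-1 * D.
  rewrite mulrAC ler_pdivlMr // mulrC; apply: le_trans (Vk k).
  by apply: le_trans (Vge k); rewrite lerDr mulr_ge0 ?sqr_ge0 ?invr_ge0 ?ltW.
split=> [k|]; first by split.
pose C := tau * D + (1 / sigma - alpha * eta4 * L ^+ 2)^-1 * D.
have xyk k : `|x k - xs| ^+ 2 + `|y k - ys| ^+ 2 <= C * alpha ^+ k.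
  by apply: le_trans (lerD (xk k) (yk k)) _; rewrite /C; lra.
split; [by rewrite alpha_gt0| |by exists C].
have a01 : 0 <= alpha < 1 by rewrite (ltW alpha_gt0).
apply: cvg_pair.
  apply: (cvg_sqr_dist_geometric (C := C) a01) => k.
  by apply: le_trans (xyk k); rewrite lerDl sqr_ge0.
apply: (cvg_sqr_dist_geometric (C := C) a01) => k.
by apply: le_trans (xyk k); rewrite lerDr sqr_ge0.
Qed.
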